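(* Let $\mathcal{G}$ be an mDAG with vertex set $V$, let $v\in V$ be a fixable vertex of $\mathcal{G}$, and let $\mathcal{G}^*$ be the graph obtained from $\mathcal{G}$ by fixing $v$. Suppose that fixing $v$ leads directly to a non-trivial nested constraint. Then the conditional independence model implied by $\mathcal{G}$ after the fixing is not faithfully represented by any DAG; that is, there is no DAG $\mathcal{H}$ with vertex set $V$ such that for all pairwise disjoint $A,B,C\subseteq V$ one has $A\perp_m B\mid C$ in $\mathcal{H}$ if and only if $A\perp_m B\mid C$ in $\mathcal{G}^*$.
   Context: An mDAG $\mathcal{G}=(V,\mathcal{D},\mathcal{B})$ is a directed acyclic graph (DAG) $(V,\mathcal{D})$ on a finite vertex set together with an abstract simplicial complex $\mathcal{B}$ over $V$ (containing all singletons), whose elements are called bidirected faces. Write $v\to w$ if $(v,w)\in\mathcal{D}$, and $v\leftrightarrow w$ if $v\neq w$ lie in a common bidirected face. A DAG is regarded as an mDAG with only singleton faces. $\mathrm{pa}(S)$ is the set of parents of elements of $S$; $\mathrm{de}(v)$ is the set of vertices reachable from $v$ by a directed path, including $v$; the district $\mathrm{dis}(v)$ is the set of vertices $w$ with $w=v$ or $w\leftrightarrow\cdots\leftrightarrow v$. m-separation: a path is a sequence of distinct vertices $v_0,\dots,v_k$ with a chosen edge ($\to$, $\leftarrow$ or $\leftrightarrow$) between each consecutive pair. An internal vertex is a collider on the path if both adjacent path edges have an arrowhead at it (a $\leftrightarrow$ edge has arrowheads at both ends), otherwise a non-collider. A path is open given $C$ if no non-collider on it is in $C$ and each collider has a directed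 path (possibly of length zero) to an element of $C$; otherwise it is blocked. For disjoint $A,B,C$, $A\perp_m B\mid C$ means every path from an element of $A$ to an element of $B$ is blocked given $C$. A distribution $p$ of $X_V=(X_v)_{v\in V}$ satisfies the global Markov property for $\mathcal{G}$ if $A\perp_m B\mid C$ in $\mathcal{G}$ implies that $X_A$ and $X_B$ are conditionally independent given $X_C$ under $p$. Fixing: $v$ is fixable in $\mathcal{G}$ if $\mathrm{de}(v)\cap\mathrm{dis}(v)=\{v\}$. Its Markov blanket is $\mathrm{mb}(v)=(\mathrm{dis}(v)\setminus\{v\})\cup\mathrm{pa}(\mathrm{dis}(v))$. Fixing a fixable $v$ yields the mDAG $\mathcal{G}^*$ with the same vertex set $V$, directed edges $\mathcal{D}\cap (V\times(V\setminus\{v\}))$, and bidirected faces those elements of $\mathcal{B}$ not containing $v$ (together with the singleton $\{v\}$). On strictly positive distributions $p$ of $X_V$, fixing $v$ yields $$p^*(x_V)=\frac{p^*(x_v)}{p(x_v\mid x_{\mathrm{mb}(v)})}\,p(x_V),$$ where $p^*(x_v)$ is an arbitrary strictly positive distribution on the state space of $X_v$. Fixing $v$ leads directly to a non-trivial nested constraint if some conditional independence implied by $\mathcal{G}^*$ for $p^*$ is not already a consequence of the ordinary conditional independences of $\mathcal{G}$: i.e. there exist disjoint $A,B,C\subseteq V$ with $A\perp_m B\mid C$ in $\mathcal{G}^*$, finite state spaces, and a strictly positive distribution $p$ satisfying the global Markov property for $\mathcal{G}$, such that $X_A$ and $X_B$ are not conditionally independent given $X_C$ under $p^*$. *)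

(* Defs.v *)
From HB Require Import structures.
From mathcomp Require Import all_boot all_order all_algebra.
From mathcomp Require Import reals.

Set Implicit Arguments.
Unset Strict Implicit.
Unset Printing Implicit Defensive.

Import Order.TTheory GRing.Theory Num.Theory.
Local Open Scope ring_scope.

Definition acyclic (V : finType) (e : rel V) : Prop :=
  forall s : seq V, s != [::] -> ~~ cycle e s.

(* The empty set is not counted as a face; this affects none of the notions
   below. *)
Record mDAG (V : finType) := MDAG {
  edge : rel V;
  faces : {set {set V}};
  edge_acyclic : acyclic edge;
  faces_neq0 : set0 \notin faces;
  faces_set1 : forall v, [set v] \in faces;
  faces_sub : forall A B : {set V},
    A \in faces -> B \subset A -> B != set0 -> B \in faces }.

Definition is_dag (V : finType) (G : mDAG V) : Prop :=
  forall F, F \in faces G -> exists v, F = [set v].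

Definition disjoint3 (V : finType) (A B C : {set V}) : bool :=
  [&& [disjoint A & B], [disjoint A & C] & [disjoint B & C]].

Section Graph.
Variables (V : finType) (G : mDAG V).

Definition bidir : rel V :=
  [rel v w | (v != w) && [exists F in faces G, (v \in F) && (w \in F)]].

Definition pa (S : {set V}) : {set V} :=
  [set u | [exists w in S, edge G u w]].
Definition de (v : V) : {set V} := [set w | connect (edge G) v w].
Definition dis (v : V) : {set V} := [set w | connect bidir v w].

Definition fixable (v : V) : bool := de v :&: dis v == [set v].
Definition mb (v : V) : {set V} := (dis v :\ v) :|: pa (dis v).

End Graph.

Inductive arrow := Fwd | Bwd | Bid.

Definition head_at_start (k : arrow) : bool :=
  match k with Fwd => false | Bwd | Bid => true end.
Definition head_at_end (k : arrow) : bool :=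
  match k with Bwd => false | Fwd | Bid => true end.

Section Separation.
Variables (V : finType) (G : mDAG V).

Definition has_arrow (k : arrow) (x y : V) : bool :=
  match k with
  | Fwd => edge G x y
  | Bwd => edge G y x
  | Bid => bidir G x y
  end.

(* The path x = v_0, v_1, ..., v_n is represented by its start x and the
   sequence (k_1, v_1), ..., (k_n, v_n), where k_i is the kind of the chosen
   edge from v_(i-1) to v_i. *)
Fixpoint walk (x : V) (s : seq (arrow * V)) : bool :=
  if s is (k, y) :: s' then has_arrow k x y && walk y s' else true.

Definition is_path (x : V) (s : seq (arrow * V)) : bool :=
  walk x s && uniq (x :: unzip2 s).

(* The two endpoints are never tested: the start is not stored in s, and the
   last vertex has no outgoing path edge. *)
Fixpoint open_given (C : {set V}) (s : seq (arrow * V)) : bool :=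
  if s is (k, y) :: s' then
    (if s' is (k', _) :: _ then
       if head_at_end k && head_at_start k'
       then [exists c in C, connect (edge G) y c]
       else y \notin C
     else true) && open_given C s'
  else true.

Definition msep (A B C : {set V}) : Prop :=
  forall x s, is_path x s -> x \in A -> last x (unzip2 s) \in B ->
    ~~ open_given C s.

End Separation.

Section Fixing.
Variables (V : finType) (G : mDAG V) (v : V).

Definition fix_edge : rel V := [rel u w | edge G u w && (w != v)].
Definition fix_faces : {set {set V}} :=
  [set v] |: [set F in faces G | v \notin F].

Lemma fix_edge_acyclic : acyclic fix_edge.
Proof.
move=> s s0; apply/negP => cs; have := edge_acyclic G s0; apply/negP.
rewrite negbK; move: cs; apply: sub_cycle => x y /andP[] //.
Qed.

Lemma fix_faces_neq0 : set0 \notin fix_faces.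
Proof.
rewrite !inE (negPf (faces_neq0 G)) orbF; apply/eqP => /setP/(_ v).
by rewrite !inE eqxx.
Qed.

Lemma fix_faces_set1 u : [set u] \in fix_faces.
Proof.
rewrite !inE faces_set1 /=; have [->|nuv] := eqVneq u v; first by rewrite eqxx.
by rewrite orbT.
Qed.

Lemma fix_faces_sub (A B : {set V}) :
  A \in fix_faces -> B \subset A -> B != set0 -> B \in fix_faces.
Proof.
rewrite !inE => /orP[/eqP-> | /andP[fA vA]] BA B0.
  by rewrite subset1 (negPf B0) orbF in BA; rewrite BA.
rewrite (faces_sub fA BA B0) /=; apply/orP; right.
by apply: contra vA; apply: (subsetP BA).
Qed.

Definition fix_vertex : mDAG V :=
  MDAG fix_edge_acyclic fix_faces_neq0 fix_faces_set1 fix_faces_sub.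

End Fixing.

Definition pos_dist (R : realType) (T : finType) (p : T -> R) : Prop :=
  (forall t, 0 < p t) /\ \sum_t p t = 1.

Definition state (V : finType) (X : V -> finType) : finType :=
  {dffun forall v : V, X v}.

Section Distributions.
Variables (R : realType) (V : finType) (X : V -> finType).
Implicit Types (p : state X -> R) (A B C S : {set V}) (x : state X).

(* marg p S x is p(x_S): only the coordinates of x in S matter. *)
Definition marg p S x : R :=
  \sum_(y : state X | [forall u in S, y u == x u]) p y.

Definition condp p A C x : R := marg p (A :|: C) x / marg p C x.

Definition cond_indep p A B C : Prop :=
  forall x, 0 < marg p C x ->
    condp p (A :|: B) C x = condp p A C x * condp p B C x.

Definition global_markov (G : mDAG V) p : Prop :=
  forall A B C, disjoint3 A B C -> msep G A B C -> cond_indep p A B C.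

Definition fix_dist (G : mDAG V) (v : V) (q : X v -> R) p : state X -> R :=
  fun x => q (x v) / condp p [set v] (mb G v) x * p x.

End Distributions.

(* q is the arbitrary strictly positive law p*(x_v) of the fixed vertex. *)
Definition nontrivial_nested_constraint
    (R : realType) (V : finType) (G : mDAG V) (v : V) : Prop :=
  exists A B C : {set V},
    [/\ disjoint3 A B C, msep (fix_vertex G v) A B C &
        exists (X : V -> finType) (p : state X -> R) (q : X v -> R),
          [/\ pos_dist p, pos_dist q, global_markov G p &
              ~ cond_indep (fix_dist G q p) A B C]].

(* Main.v *)
Require Import Defs.
From mathcomp Require Import all_boot all_order all_algebra.
From mathcomp Require Import reals ring.

(* Contrapositive: if a DAG [H] has the separations of [G'] = [fix_vertex G v],
   then [fix_dist G q p] factorizes along [H], hence satisfies all of them.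
   Write N for the nondescendants of [v] in [G].  As [v] and N are separated in
   [G'] and hence in [H], N is ancestral in [H] and does not touch [v]; there
   [fix_dist] has the same marginals as [p].  Build [H] up by adding sinks to
   N.  For a strict descendant [d] of [v] and [u], both in a set [S] that
   contains N and [v], a separation of [d] and [u] given the rest of [S] in [G']
   also holds in [G], so it holds for [p]; and it passes to [fix_dist], whose
   density with respect to [p] on [S] does not involve [d].  Positivity turns
   these pairwise independences into a factorization.  The vertices that precede
   [v] in [H] are the delicate ones, as [S] then does not contain [v].  There
   [H] has no unshielded colliders, so that pairwise independence survives when
   the sinks are summed out one by one, starting from a set that contains [v]. *)

Set Implicit Arguments.
Unset Strict Implicit.
Unset Printing Implicit Defensive.

Import Order.TTheory GRing.Theory Num.Theory.

(** * Walks and separation *)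

Section Walks.
Variables (V : finType) (G : mDAG V).
Implicit Types (C S : {set V}) (x y z : V).

Lemma edge_no_loop x y : edge G x y -> ~~ connect (edge G) y x.
Proof.
move=> exy; apply/negP => /connectP[p yp xE].
have := @edge_acyclic _ G (y :: p) isT.
by rewrite /= rcons_path yp -xE exy.
Qed.

Lemma bidirC x y : bidir G x y = bidir G y x.
Proof.
rewrite /bidir /= eq_sym; congr andb.
by apply: eq_existsb => F; rewrite (andbC (x \in F)).
Qed.

Lemma exists_sink S : S != set0 -> exists2 w, w \in S & {in S, forall u, ~~ edge G w u}.
Proof.
move=> /set0Pn[w0 w0S].
case: (arg_minnP (fun w => #|[set u | connect (edge G) w u]|) w0S) => w wS wmin.
exists w => // u uS; apply/negP => ewu.
have := wmin _ uS; apply/negP; rewrite -ltnNge; apply: proper_card.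
apply/properP; split; first by apply/subsetP => z; rewrite !inE; apply: connect_trans; apply: connect1.
by exists w; rewrite !inE ?connect0 ?edge_no_loop.
Qed.

Lemma exists_source S :
  S != set0 -> exists2 w, w \in S & {in S, forall u, ~~ edge G u w}.
Proof.
move=> /set0Pn[w0 w0S].
case: (arg_minnP (fun w => #|[set u | connect (edge G) u w]|) w0S) => w wS wmin.
exists w => // u uS; apply/negP => euw.
have := wmin _ uS; apply/negP; rewrite -ltnNge; apply: proper_card.
apply/properP; split.
  by apply/subsetP => z; rewrite !inE => zu; apply: connect_trans zu (connect1 euw).
by exists w; rewrite !inE ?connect0 ?edge_no_loop.
Qed.

(* [wreach C x y h]: some walk from [x] to [y] has colliders exactly at its
   internal visits to [C]; [h] records whether it enters [y] with an arrowhead.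
   Unlike for open paths, vertices may repeat, so such walks compose. *)
Inductive wreach C x : V -> bool -> Prop :=
| wreach1 y k : has_arrow G k x y -> wreach C x y (head_at_end k)
| wreachS y h z k : wreach C x y h -> has_arrow G k y z ->
    h && head_at_start k = (y \in C) -> wreach C x z (head_at_end k).

(** The walk goes down to the first vertex of [C] and back the same way. The turning point is a
    collider in [C], all other vertices passed are non-colliders outside [C], and [y] is re-entered
    by a tail. *)
Lemma wreach_detour C x y h c :
  wreach C x y h -> y \notin C -> c \in C -> connect (edge G) y c ->
  wreach C x y false.
Proof.
move=> + + cC /connectP[p yp cE].
elim: p y h yp cE => [|z p IHp] y h /=; first by move=> _ <- _; rewrite cC.
move=> /andP[eyz zp] cE xy yC.
have xz : wreach C x z true.
  by apply: (@wreachS C x y h z Fwd) => //; rewrite andbF (negPf yC).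
case: (boolP (z \in C)) => zC.
  by apply: (@wreachS C x z true y Bwd); rewrite ?zC.
apply: (@wreachS C x z false y Bwd) => //; last by rewrite (negPf zC).
exact: IHp zp cE xz zC.
Qed.

(** An open collider outside [C] is replaced by a detour to its descendant in [C], after which it is
    left as a non-collider. *)
Lemma open_walk_wreach C x k y s :
  walk G y s -> open_given G C ((k, y) :: s) -> wreach C x y (head_at_end k) ->
  exists h, wreach C x (last y (unzip2 s)) h.
Proof.
elim: s k y => [|[k' z] s IHs] k y /=; first by move=> _ _ ?; exists (head_at_end k).
move=> /andP[yz zs] /andP[+ os] xy.
case: ifP => [/andP[hk hk'] /exists_inP[c cC yc]|nc yC].
  apply: (IHs k') => //.
  case: (boolP (y \in C)) => yC; first by apply: wreachS xy yz _; rewrite hk hk' yC.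
  by apply: wreachS (wreach_detour xy yC cC yc) yz _; rewrite (negPf yC).
by apply: (IHs k') => //; apply: wreachS xy yz _; rewrite nc (negPf yC).
Qed.

(** The step [(k, y)] occurs in both parts: the second needs the end of [k] to decide whether [y] is
    a collider. *)
Lemma open_given_cat C s k y t :
  open_given G C (rcons s (k, y) ++ t) =
  open_given G C (rcons s (k, y)) && open_given G C ((k, y) :: t).
Proof.
elim: s => [|[k1 y1] s IHs]; first by [].
rewrite rcons_cons cat_cons.
have -> a u : open_given G C (a :: u) = (if u is (k', _) :: _ then
       if head_at_end a.1 && head_at_start k'
       then [exists c in C, connect (edge G) a.2 c]
       else a.2 \notin C
     else true) && open_given G C u by case: a.
rewrite IHs andbA; congr (_ && _).
by rewrite -[in RHS]/(open_given G C ((k1, y1) :: rcons s (k, y))) /=; case: s {IHs} => [|[]].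
Qed.

Lemma walk_cat x s t :
  walk G x (s ++ t) = walk G x s && walk G (last x (unzip2 s)) t.
Proof. by elim: s x => [|[k y] s IHs] x //=; rewrite IHs andbA. Qed.

Lemma last_unzip2_rcons (x y : V) (k : arrow) s : last x (unzip2 (rcons s (k, y))) = y.
Proof. by rewrite /unzip2 map_rcons last_rcons. Qed.

Lemma wreach_walk C x y h : wreach C x y h ->
  exists s k, [/\ walk G x (rcons s (k, y)), open_given G C (rcons s (k, y))
               & h = head_at_end k].
Proof.
elim=> {y h} [y k xy|y h z k _ [s [k' [ws os ->]]] yz yC].
  by exists [::], k; rewrite /= xy.
exists (rcons s (k', y)), k; split=> //.
  by rewrite -cats1 walk_cat ws last_unzip2_rcons /= yz.
rewrite -cats1 open_given_cat os /= yC andbT.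
by case: ifPn => // yC'; apply/exists_inP; exists y; rewrite ?connect0.
Qed.

Lemma in_unzip2_split (y : V) (s : seq (arrow * V)) : y \in unzip2 s ->
  exists a k b, s = rcons a (k, y) ++ b.
Proof.
elim: s => [|[k z] s IHs] //=; rewrite inE.
have [<- _|_ /= /IHs[a [k' [b ->]]]] := eqVneq y z; first by exists [::], k, s.
by exists ((k, z) :: a), k', b.
Qed.

Lemma not_uniq_unzip2_split (s : seq (arrow * V)) : ~~ uniq (unzip2 s) ->
  exists y a k b k' c, s = rcons a (k, y) ++ (rcons b (k', y) ++ c).
Proof.
elim: s => [|[k y] s IHs] //=; rewrite negb_and negbK.
case/orP => [/in_unzip2_split[b [k' [c ->]]]|/IHs[z [a [k' [b [k'' [c ->]]]]]]].
  by exists y, [::], k, b, k', c.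
by exists z, ((k, y) :: a), k', b, k'', c.
Qed.

(** The walk descends from [z] as long as it follows edges forwards. The first vertex where it does
    not is an open collider, hence an ancestor of [C]. *)
Lemma open_walk_descends C k z t :
  head_at_end k -> walk G z t -> open_given G C ((k, z) :: t) ->
  [exists c in C, connect (edge G) z c] \/ connect (edge G) z (last z (unzip2 t)).
Proof.
elim: t k z => [|[k' z'] t IHt] k z hk; first by right; exact: connect0.
move=> /andP[zz' wt] /andP[+ ot]; rewrite hk /=.
case: (boolP (head_at_start k')) => hk'; first by left.
case: k' => // in zz' ot hk' * => _.
have [/exists_inP[c cC z'c]|z't] := IHt Fwd z' isT wt ot; [left|right].
  by apply/exists_inP; exists c => //; apply: connect_trans z'c; exact: connect1.
by apply: connect_trans z't; exact: connect1.
Qed.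

(* Cut out the closed part of the walk between two visits of the same vertex
   [y].  If [y] becomes a collider by this, it must be an ancestor of [C]: else
   the removed part would be a directed cycle through [y]. *)
Lemma open_walk_path C x s : walk G x s -> open_given G C s ->
  exists s', [/\ is_path G x s', open_given G C s'
              & last x (unzip2 s') = last x (unzip2 s)].
Proof.
have [n] := ubnP (size s); elim: n s => // n IHn s /ltnSE-sn ws os.
have [us|] := boolP (uniq (x :: unzip2 s)); first by exists s; rewrite /is_path ws us.
rewrite /= negb_and negbK.
(* If [x] itself is revisited, the part after that visit is already an open walk from [x]. *)
case/orP => [/in_unzip2_split[a [k [b sE]]]|/not_uniq_unzip2_split].
  have bn : size b < n.
    by apply: leq_trans sn; rewrite sE size_cat size_rcons addSn ltnS leq_addl.
  move: ws os; rewrite sE walk_cat open_given_cat last_unzip2_rcons.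
  move=> /andP[_ wb] /andP[_ /andP[_ ob]].
  have [s' [? ? s'E]] := IHn b bn wb ob; exists s'; split=> //.
  by rewrite s'E /unzip2 map_cat last_cat -/unzip2 last_unzip2_rcons.
case=> y [a [k [b [k' [c sE]]]]].
have cn : size (rcons a (k, y) ++ c) < n.
  by apply: leq_trans sn; rewrite sE !size_cat !size_rcons ltn_add2l addSn ltnS leq_addl.
suff [wc oc] : walk G x (rcons a (k, y) ++ c) /\ open_given G C (rcons a (k, y) ++ c).
  have [s' [? ? s'E]] := IHn _ cn wc oc; exists s'; split=> //.
  by rewrite s'E sE /unzip2 !map_cat !last_cat -/unzip2 !last_unzip2_rcons.
move: ws os; rewrite sE !walk_cat !last_unzip2_rcons => /and3P[wa wb wc].
rewrite wa wc !open_given_cat -cat_cons -rcons_cons open_given_cat.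
move=> /and3P[oa ob oc]; split=> //; rewrite oa /=.
case: c => [|[k3 z] c] // in oc wc sE cn *.
move: oc => /= /andP[oc ->]; rewrite andbT.
rewrite rcons_cons in ob; have lE := last_unzip2_rcons y y k' b.
have tn : 0 < size (rcons b (k', y)) by rewrite size_rcons.
case: (rcons b (k', y)) tn ob wb lE {sE} => [|[k1 y1] b1] //= _ /andP[ob ob1] /andP[yy1 wb] lE.
case: ifPn => [/andP[hk hk3]|]; last first.
  by rewrite negb_and => /orP[] /negPf h; [move: ob|move: oc]; rewrite h ?andbF.
move: ob; rewrite hk /=; case: ifP => // hk1 _.
case: k1 yy1 ob1 hk1 => // yy1 ob1 _.
have [/exists_inP[c' c'C y1c']|] := open_walk_descends (isT : head_at_end Fwd) wb ob1.
  by apply/exists_inP; exists c' => //; apply: connect_trans y1c'; apply: connect1.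
by rewrite lE (negPf (edge_no_loop yy1)).
Qed.

(** Open paths become [wreach] walks by detours at colliders; [wreach] walks become open paths by
    cutting out loops. *)
Lemma msepPn (A B C : {set V}) : disjoint3 A B C ->
  msep G A B C <-> forall x y h, x \in A -> y \in B -> ~ wreach C x y h.
Proof.
move=> /and3P[AB AC BC]; split=> [sep x y h xA yB /wreach_walk[s [k [ws os _]]]|sep x s].
  have [s' [ps' os' s'E]] := open_walk_path ws os.
  by have := sep x s' ps' xA; rewrite s'E last_unzip2_rcons os' => /(_ yB).
case: s => [|[k y] s] /=.
  by move=> _ xA xB; have := disjointFr AB xA; rewrite xB.
move=> /andP[/andP[xy ws] _] xA yB; apply/negP => os.
have [h] := open_walk_wreach ws os (wreach1 C xy).
exact: sep.
Qed.

(** No vertex below [w] is in [C], so the vertices passed on the way down are open non-colliders.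
    The case [x = w] stands for the walk without edges, which [wreach] excludes. *)
Lemma wreach_down C x w h b :
  (x = w \/ wreach C x w h) -> connect (edge G) w b ->
  (forall c, c \in C -> ~~ connect (edge G) w c) ->
  x = b \/ exists h', wreach C x b h'.
Proof.
move=> + /connectP[p wp ->].
elim: p w h wp => [|z p IHp] w h /=; first by move=> _ [->|xw] _; [left|right; exists h].
move=> /andP[ewz zp] xw nC; apply: (IHp z true) => // [|c cC].
  right; have wC : w \notin C by apply/negP => /nC; rewrite connect0.
  case: xw => [->|xw]; first exact: (@wreach1 C w z Fwd).
  by apply: (wreachS (k := Fwd) xw) => //; rewrite andbF (negPf wC).
by apply: contra (nC c cC); apply: connect_trans; apply: connect1.
Qed.

Lemma wreach_up C x w :
  connect (edge G) w x -> (forall c, c \in C -> ~~ connect (edge G) w c) ->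
  x = w \/ wreach C x w false.
Proof.
move=> /connectP[p + xE]; rewrite {x}xE.
elim: p w => [|z p IHp] w /=; first by left.
move=> /andP[ewz zp] nC; right.
have {}nC c : c \in C -> ~~ connect (edge G) z c.
  by move=> cC; apply: contra (nC c cC); apply: connect_trans; apply: connect1.
have zC : z \notin C by apply/negP => /nC; rewrite connect0.
case: (IHp z zp nC) => [->|xz]; first exact: (@wreach1 C z w Bwd).
by apply: (wreachS (k := Bwd) xz) => //; rewrite (negPf zC).
Qed.

Definition wsep C x y := forall h, ~ wreach C x y h.

Lemma wsepP C x y : x != y -> x \notin C -> y \notin C ->
  wsep C x y <-> msep G [set x] [set y] C.
Proof.
move=> xy xC yC; rewrite msepPn; last first.
  by rewrite /disjoint3 !disjoints1 inE xy xC yC.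
by split=> [sep ? ? h /set1P-> /set1P->|sep h]; [exact: sep|apply: sep; rewrite set11].
Qed.

Definition ancestral S := forall u w, edge G u w -> w \in S -> u \in S.

Lemma ancestral_closure (A : {set V}) :
  ancestral [set u | [exists a in A, connect (edge G) u a]].
Proof.
move=> u w uw; rewrite !inE => /exists_inP[a aA wa]; apply/exists_inP; exists a => //.
exact: connect_trans (connect1 uw) wa.
Qed.

(** A vertex of [S] entered by an arrowhead is a child of [a]; a vertex entered by a tail is [a] or
    conditioned on. [b] is neither. Turning back at a collider cannot lead to [b], as [a] and [b]
    have no common child in [S]. *)
Lemma dag_wsep_pair S a b : is_dag G -> ancestral S ->
  a \in S -> b \in S -> a != b -> ~~ edge G a b -> ~~ edge G b a ->
  {in S, forall c, ~~ (edge G a c && edge G b c)} ->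
  wsep (S :\: [set a; b]) a b.
Proof.
move=> Gdag Sanc aS bS ab nab nba nch h.
have nbid u w : bidir G u w = false.
  apply/negP => /andP[uw /exists_inP[F /Gdag[z ->]]].
  by rewrite !inE => /andP[/eqP uz /eqP wz]; rewrite uz wz eqxx in uw.
have parent z y : edge G z y -> y \in S -> z != b -> z = a \/ z \in S :\: [set a; b].
  move=> ezy yS zb; have [->|za] := eqVneq z a; first by left.
  by right; rewrite !inE (negPf za) (negPf zb) (Sanc _ _ ezy).
suff inv y h' : wreach (S :\: [set a; b]) a y h' ->
    if h' then y \in S -> edge G a y else y = a \/ y \in S :\: [set a; b].
  move=> /inv; case: h => [/(_ bS)|[E|]]; first by rewrite (negPf nab).
    by rewrite E eqxx in ab.
  by rewrite !inE eqxx orbT.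
elim=> {y h'} [y []|y h' z k _ IH].
- by move=> /= ay _.
- move=> /= eya; apply: (parent _ _ eya aS).
  by apply: contraTneq eya => ->.
- by rewrite /= nbid.
case: h' IH => [ay|yE]; last first.
  case: yE => [->|->] //.
  case: k => /=; last by rewrite nbid.
    by [].
  move=> eza _; apply: (parent _ _ eza aS).
  by apply: contraTneq eza => ->.
case: k => /=; last by rewrite nbid.
  move=> eyz yC zS; have yS := Sanc _ _ eyz zS; move: yC.
  have ya : y != a by apply: contraTneq (ay yS) => ->; apply/negP => /edge_no_loop; rewrite connect0.
  have yb : y != b by apply: contraTneq (ay yS) => ->.
  by rewrite !inE yS (negPf ya) (negPf yb).
move=> ezy /esym/setDP[yS _]; apply: (parent _ _ ezy yS).
by apply: contraTneq ezy => ->; have := nch y yS; rewrite (ay yS).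
Qed.

End Walks.

(** * Separation before and after fixing *)

Section FixSeparation.
Variables (V : finType) (G : mDAG V) (v : V).
Hypothesis v_fixable : fixable G v.
Implicit Types (C S : {set V}) (x y z : V).
Local Notation G' := (fix_vertex G v).

Lemma bidir_fix u w : bidir G' u w = [&& bidir G u w, u != v & w != v].
Proof.
apply/andP/and3P => [[uw /exists_inP[F]]|[/andP[uw /exists_inP[F FG /andP[uF wF]]] uv wv]].
  rewrite !inE => /orP[/eqP->|/andP[FG vF]].
    by rewrite !inE => /andP[/eqP E /eqP E']; rewrite E E' eqxx in uw.
  move=> /andP[uF wF]; split.
  - by rewrite /bidir /= uw; apply/exists_inP; exists F; rewrite ?uF.
  - by apply: contraNneq vF => <-.
  - by apply: contraNneq vF => <-.
split=> //; apply/exists_inP; exists [set u; w]; last by rewrite !inE !eqxx orbT.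
rewrite !inE; apply/orP; right; rewrite eq_sym (negPf uv) eq_sym (negPf wv) andbT.
apply: (faces_sub FG); first by apply/subsetP => z /set2P[]->.
by apply/set0Pn; exists u; rewrite !inE eqxx.
Qed.

Lemma has_arrow_fix k u w : has_arrow G k u w ->
  (head_at_start k -> u != v) -> (head_at_end k -> w != v) -> has_arrow G' k u w.
Proof.
case: k => uw uv wv; last by rewrite [has_arrow _ _ _ _]bidir_fix [bidir _ _ _]uw uv // wv.
  by apply/andP; split=> //; apply: wv.
by apply/andP; split=> //; apply: uv.
Qed.

Lemma dis_de y : y \in dis G v -> y \in de G v -> y = v.
Proof.
by move=> yd yD; apply/set1P; rewrite -(eqP v_fixable) inE yd yD.
Qed.

Lemma v_dis : v \in dis G v. Proof. by rewrite inE connect0. Qed.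
Lemma v_de : v \in de G v. Proof. by rewrite inE connect0. Qed.

Lemma de_edge y z : y \in de G v -> edge G y z -> z \in de G v.
Proof. by rewrite !inE => vy /connect1; apply: connect_trans. Qed.

Lemma de_edge_neq y z : y \in de G v -> edge G y z -> z != v.
Proof.
by rewrite inE => vy yz; apply: contraTneq yz => ->; apply/negP => /edge_no_loop; rewrite vy.
Qed.

(** If [y] descended from [v], so would [z], and fixability would force [z = v]; but an edge from a
    descendant of [v] into [v] closes a cycle. *)
Lemma pa_dis_nd y z : edge G y z -> z \in dis G v -> y \notin de G v.
Proof.
move=> yz zd; apply/negP => yD; have := de_edge_neq yD yz.
by rewrite (dis_de zd (de_edge yD yz)) eqxx.
Qed.

Lemma pa_dis_mb y z : edge G y z -> z \in dis G v -> y \in mb G v.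
Proof. by move=> yz zd; rewrite !inE; apply/orP; right; apply/exists_inP; exists z. Qed.

Lemma dis_mb y : y \in dis G v -> y != v -> y \in mb G v.
Proof. by move=> yd yv; rewrite in_setU in_setD1 yv yd. Qed.

Lemma dis_bidir y z : bidir G y z -> (y \in dis G v) = (z \in dis G v).
Proof.
rewrite !inE => yz; apply/idP/idP => vy; apply: (connect_trans vy); apply: connect1 => //.
by rewrite bidirC.
Qed.

Lemma mb_nd y : y \in mb G v -> y \notin de G v.
Proof.
rewrite in_setU in_setD1 => /orP[/andP[yv yd]|].
  by apply/negP => /(dis_de yd) E; rewrite E eqxx in yv.
by rewrite inE => /exists_inP[z zd yz]; apply: pa_dis_nd yz zd.
Qed.

(* In [G], no walk from a strict descendant of [v] given [S :\: [set d; x]]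
   enters the district of [v] with an arrowhead before it reaches [x]. *)
Lemma wsep_fix_transfer S d x :
  d \in de G v -> d != v -> d \in S -> x \in S -> v \in S -> ~: de G v \subset S ->
  wsep G' (S :\: [set d; x]) d x -> wsep G (S :\: [set d; x]) d x.
Proof.
move=> dD dv dS xS vS NS sep h dx.
set C := S :\: _ in sep dx.
have nd_C y : y \notin de G v -> y != x -> y \in C.
  move=> yN yx; rewrite in_setD in_set2 (negPf yx) orbF (subsetP NS) ?in_setC // andbT.
  by apply: contraNneq yN => ->.
have dis_C y : y \in dis G v -> y != x -> y \in C.
  move=> yd yx; have [yv|yv] := eqVneq y v; last exact/nd_C/yx/mb_nd/dis_mb.
    by move: yx; rewrite yv !inE vS andbT negb_or (eq_sym v d) dv.
(* The first alternative records that the walk has already met [x]. Until then no edge has an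
   arrowhead in the district, which contains [v], so all edges survive the fixing. *)
suff inv y h' : wreach G C d y h' -> (exists h'', wreach G' C d x h'') \/
    (wreach G' C d y h' /\ (h' -> y \notin dis G v)).
  by case: (inv _ _ dx) => [[h'' /sep]|[/sep]].
have step u w k : has_arrow G k u w -> u \notin dis G v ->
    (k = Fwd -> w \notin dis G v) ->
    has_arrow G' k u w /\ (head_at_end k -> w \notin dis G v).
  have neq z : z \notin dis G v -> z != v by apply: contraNneq => ->; apply: v_dis.
  move=> uw ud wd; have {}wd : head_at_end k -> w \notin dis G v.
    by case: k uw wd => //= uw wd _; [apply: wd|rewrite -(dis_bidir uw)].
  by split=> //; apply: has_arrow_fix uw _ _ => [_|/wd]; apply: neq.
elim=> {y h'} [y k dy|y h' z k dy IH yz yC].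
  have [|k1|dy' yd] := step _ _ _ dy; [| |by right; split=> //; apply: wreach1].
    by apply/negP => /dis_de/(_ dD) E; rewrite E eqxx in dv.
  by apply/negP => yd; rewrite k1 /= in dy; have := pa_dis_nd dy yd; rewrite dD.
case: IH => [|[IH yd]]; first by left.
have [yx|yx] := eqVneq y x; first by left; exists h'; rewrite -yx.
have {}yd : y \notin dis G v.
  apply/negP => yd'; move: yC; rewrite dis_C // => /andP[/yd].
  by rewrite yd'.
have [//|k1|yz' zd] := step _ _ _ yz; last by right; split=> //; apply: wreachS IH yz' yC.
(* A directed edge into the district starts at a nondescendant of [v]; this lies in [C] and blocks
   the walk as a non-collider. *)
apply/negP => zd; rewrite k1 /= in yz; move: yC; rewrite k1 andbF nd_C //.
exact: pa_dis_nd yz zd.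
Qed.

(** A walk that enters the descendants of [v] finds no collider in [C] there, so it can only go on
    forwards and never comes out. Before that it avoids [v], and its edges survive the fixing. *)
Lemma wreach_fix_nd C x y h : C \subset ~: de G v -> x \notin de G v ->
  wreach G C x y h ->
  (y \notin de G v /\ wreach G' C x y h) \/ (y \in de G v /\ h).
Proof.
move=> CN xN xy.
have stepN u w k : u \notin de G v -> w \notin de G v -> has_arrow G k u w -> has_arrow G' k u w.
  have neq z : z \notin de G v -> z != v by apply: contraNneq => ->; apply: v_de.
  by move=> uN wN uw; apply: has_arrow_fix uw _ _ => _; apply: neq.
have stepD u w k : u \notin de G v -> w \in de G v -> has_arrow G k u w -> head_at_end k.
  by case: k => //= uN wD wu; move: uN; rewrite (de_edge wD wu).
elim: xy => {y h} [y k xy|y h z k xy IH yz yC].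
  have [yD|yN] := boolP (y \in de G v); [right|left]; first by split=> //; apply: stepD xy.
  by split=> //; apply: wreach1; apply: stepN.
case: IH => [[yN IH]|[yD hT]].
  have [zD|zN] := boolP (z \in de G v); [right|left]; first by split=> //; apply: stepD yz.
  by split=> //; apply: wreachS IH _ yC; apply: stepN.
right; have yC' : y \notin C.
  by apply/negP => /(subsetP CN); rewrite inE yD.
move: yC; rewrite hT (negPf yC') /=; case: k yz => //= yz _.
by rewrite (de_edge yD yz).
Qed.

Lemma msep_fix_nd (A B C : {set V}) : disjoint3 A B C ->
  A \subset ~: de G v -> B \subset ~: de G v -> C \subset ~: de G v ->
  msep G' A B C -> msep G A B C.
Proof.
move=> dABC AN BN CN /(msepPn _ dABC) sep; apply/(msepPn _ dABC) => x y h xA yB xy.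
have xN : x \notin de G v by have := subsetP AN _ xA; rewrite inE.
have yN : y \notin de G v by have := subsetP BN _ yB; rewrite inE.
case: (wreach_fix_nd CN xN xy) => [[_]|[]]; last by rewrite (negPf yN).
exact: sep.
Qed.

(** A walk from [v] either runs forwards among the descendants of [v], or stays in the district, or
    enters the blanket by a tail and is blocked there. None of these ends at a nondescendant outside
    the blanket. *)
Lemma msep_mb : msep G [set v] (~: de G v :\: mb G v) (mb G v).
Proof.
have vmb : v \notin mb G v by apply/negP => /mb_nd; rewrite v_de.
apply/msepPn.
  rewrite /disjoint3 !disjoints1 vmb in_setD in_setC v_de andbF /=.
  by apply/pred0P => y; rewrite /= in_setD; case: (y \in mb G v); rewrite ?andbF.
move=> x y h /set1P-> yN vy.
suff inv z h' : wreach G (mb G v) v z h' ->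
    [\/ z \in de G v /\ h', z \in dis G v | z \in mb G v /\ ~~ h'].
  move: yN; rewrite in_setD in_setC; case: (inv _ _ vy) => [[->]|yd|[->]]; rewrite ?andbF //.
  have [->|yv] := eqVneq y v; first by rewrite v_de andbF.
  by rewrite dis_mb.
have step u w k : u \in dis G v -> has_arrow G k u w -> (k = Fwd -> u = v) ->
    [\/ w \in de G v /\ head_at_end k, w \in dis G v | w \in mb G v /\ ~~ head_at_end k].
  case: k => /= ud uw uv.
  - by constructor 1; split=> //; apply: de_edge uw; rewrite uv ?v_de.
  - by constructor 3; split=> //; apply: pa_dis_mb uw ud.
  - by constructor 2; rewrite -(dis_bidir uw).
elim=> {z h'} [z k vz|z h' w k _ IH zw zC]; first by apply: step vz _; rewrite ?v_dis.
case: IH => [[zD hT]|zd|[zmb hF]].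
- have zmb : z \notin mb G v by apply/negP => /mb_nd; rewrite zD.
  move: zC; rewrite hT (negPf zmb); case: k zw => //= zw _.
  by constructor 1; split=> //; apply: de_edge zw.
- apply: step zw _ => // kE; have [//|zv] := eqVneq z v.
  by move: zC; rewrite kE andbF dis_mb.
- by move: zC; rewrite (negPf hF) zmb.
Qed.

End FixSeparation.

(** * A DAG with the separations of the fixed graph *)

Section MarkovEquivalentDag.
Variables (V : finType) (G H : mDAG V) (v : V).
Hypothesis v_fixable : fixable G v.
Hypothesis H_dag : is_dag H.
Local Notation G' := (fix_vertex G v).
Hypothesis H_equiv : forall A B C : {set V}, disjoint3 A B C ->
  msep H A B C <-> msep G' A B C.
Implicit Types (C S : {set V}) (x y z : V).

Lemma wsep_equiv C x y : x != y -> x \notin C -> y \notin C ->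
  wsep H C x y <-> wsep G' C x y.
Proof.
move=> xy xC yC; rewrite !wsepP //; apply: H_equiv.
by rewrite /disjoint3 !disjoints1 inE xy xC yC.
Qed.

(** In [G'] no arrowhead points at [v], and with nothing conditioned on no collider is open: every
    walk from [v] is directed and stays among its descendants. *)
Lemma wsep_v_nd n : n \notin de G v -> wsep H set0 v n.
Proof.
move=> nN; have nv : v != n by apply: contraNneq nN => <-; apply: v_de.
apply/wsep_equiv; rewrite ?inE // => h vn.
suff inv y h' : wreach G' set0 v y h' -> y \in de G v /\ h'.
  by have [] := inv _ _ vn; rewrite (negPf nN).
elim=> {y h'} [y k|y h' z k _ [yD hT]].
  case: k => /=; last by rewrite -/(bidir G' v y) bidir_fix eqxx andbF.
    by move=> /andP[vy _]; split=> //; apply: de_edge vy; apply: v_de.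
  by rewrite /fix_edge /= eqxx andbF.
rewrite inE hT; case: k => //= /andP[yz _] _; split=> //.
exact: de_edge yD yz.
Qed.

Lemma connect_fix_de d : d \in de G v -> connect (edge G') v d.
Proof.
rewrite inE => /connectP[p vp ->].
suff key u : u \in de G v -> path (edge G) u p -> connect (edge G') u (last u p).
  exact: key (v_de G v) vp.
elim: p u {vp} => [|z p IHp] u uD /=; first by rewrite connect0.
move=> /andP[uz zp]; apply: connect_trans (IHp z (de_edge uD uz) zp).
by apply: connect1; rewrite /= /fix_edge /= uz (de_edge_neq uD uz).
Qed.

(** For [d] other than [v], the directed path from [v] to [d] in [G'] makes them dependent given
    nothing, in [H] as well. An edge from [d] to [n] would extend the walk in [H] to connect [v]
    with [n]. *)
Lemma dag_no_edge_nd d n : d \in de G v -> n \notin de G v -> ~~ edge H d n.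
Proof.
move=> dD nN; apply/negP => dn; have sep := wsep_v_nd nN.
have [dv|dv] := eqVneq d v.
  by apply: (sep true); apply: (@wreach1 _ H set0 v n Fwd); rewrite -dv.
suff: wsep G' set0 v d.
  have [] := @wreach_down _ G' set0 v v false d (or_introl erefl) (connect_fix_de dD).
  - by move=> c; rewrite inE.
  - by move=> E; rewrite E eqxx in dv.
  - by move=> [h vd] /(_ h).
apply/wsep_equiv; rewrite ?inE 1?eq_sym // => h vd; apply: (sep true).
by apply: (wreachS (k := Fwd) vd) => //; rewrite andbF inE.
Qed.

Lemma dag_anc_de u : connect (edge H) u v -> u \in de G v.
Proof.
move=> uv; apply/negPn/negP => uN.
case: (wreach_up (C := set0) uv) => [c|E|vu]; first by rewrite inE.
  by move: uN; rewrite -E v_de.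
exact: wsep_v_nd uN _ vu.
Qed.

Lemma nd_ancestral : ancestral H (~: de G v).
Proof.
move=> u w uw; rewrite !in_setC => wN; apply/negP => uD.
by have := dag_no_edge_nd uD wN; rewrite uw.
Qed.

(* Adding [v] to the conditioning set opens no walk in [G'], where [v] has no
   incoming arrowhead, whereas in [H] it would open the collider [c]. *)
Lemma dag_moral a b c : connect (edge H) c v -> edge H a c -> edge H b c ->
  a != b -> edge H a b || edge H b a.
Proof.
move=> cv ac bc ab; apply: contraT; rewrite negb_or => /andP[nab nba].
(* By acyclicity the ancestral closure of [a] and [b] misses [c] and its descendants, in particular
   [v]. *)
pose S := [set u | [exists w in [set a; b], connect (edge H) u w]].
have S_anc := @ancestral_closure _ H [set a; b] : ancestral H S.
have S_c u : connect (edge H) c u -> u \notin S.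
  move=> cu; rewrite inE; apply/negP => /exists_inP[w /set2P[]-> uw].
    by have := edge_no_loop ac; rewrite (connect_trans cu uw).
  by have := edge_no_loop bc; rewrite (connect_trans cu uw).
have aS : a \in S by rewrite inE; apply/exists_inP; exists a; rewrite ?set21 ?connect0.
have bS : b \in S by rewrite inE; apply/exists_inP; exists b; rewrite ?set22 ?connect0.
have nch : {in S, forall z, ~~ (edge H a z && edge H b z)}.
  move=> z; rewrite inE => /exists_inP[w /set2P[]-> zw]; apply/negP => /andP[az bz].
    by have := edge_no_loop az; rewrite zw.
  by have := edge_no_loop bz; rewrite zw.
have sep := dag_wsep_pair H_dag S_anc aS bS ab nab nba nch.
set C := S :\: _ in sep.
have aC : a \notin C by rewrite !inE eqxx.
have bC : b \notin C by rewrite !inE eqxx orbT.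
have vC : v \notin C by rewrite in_setD (negPf (S_c v cv)) andbF.
have av : a != v by apply: contraNneq (S_c v cv) => <-.
have bv : b != v by apply: contraNneq (S_c v cv) => <-.
have {}sep : wsep G' C a b by apply/wsep_equiv.
have {sep} : wsep G' (v |: C) a b.
  move=> h abh.
  suff inv y h' : wreach G' (v |: C) a y h' -> wreach G' C a y h' /\ (h' -> y != v).
    by apply: (sep h); case: (inv _ _ abh).
  have head k u w : has_arrow G' k u w -> head_at_end k -> w != v.
    case: k => //= [/andP[]//|]; rewrite -/(bidir G' u w) bidir_fix.
    by move=> /and3P[].
  elim=> {y h'} [y k ay|y h' z k _ [ay hy] yz yC].
    by split; [exact: wreach1|exact: head ay].
  split; last exact: head yz.
  apply: wreachS ay yz _; rewrite yC in_setU1.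
  have [yv|//] := eqVneq y v; move: yC; rewrite yv in_setU1 eqxx /=.
  by move=> /andP[/hy]; rewrite yv eqxx.
have aC' : a \notin v |: C by rewrite in_setU1 negb_or av.
have bC' : b \notin v |: C by rewrite in_setU1 negb_or bv.
move=> /(wsep_equiv ab aC' bC')/(wsepP _ ab aC' bC')/(_ a [:: (Fwd, c); (Bwd, b)]).
have ca : a != c by apply: contraTneq ac => ->; apply/negP => /edge_no_loop; rewrite connect0.
have cb : b != c by apply: contraTneq bc => ->; apply/negP => /edge_no_loop; rewrite connect0.
rewrite /is_path /= ac bc !inE !negb_or ca ab eq_sym cb !eqxx => /(_ isT isT isT).
rewrite andbT => /negP[]; apply/exists_inP; exists v; rewrite ?in_setU1 ?eqxx //.
Qed.

End MarkovEquivalentDag.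

(** * Separation in the moral graph of an ancestral set *)

Definition moral_edge (V : finType) (H : mDAG V) (S C : {set V}) : rel V :=
  [rel u w | [&& u \in S :\: C, w \in S :\: C &
    [|| edge H u w, edge H w u | [exists z in S, edge H u z && edge H w z]]]].

Section Moralization.
Variables (V : finType) (H : mDAG V) (A B C : {set V}).
Hypothesis dABC : disjoint3 A B C.
Hypothesis sep : msep H A B C.
Local Notation S := [set u | [exists w in A :|: B :|: C, connect (edge H) u w]].

(** [J w] says that a walk from [A] can leave [w] by any edge without making [w] a collider, and
    moral edges preserve [J]. A vertex entered by an arrowhead regains [J] as an ancestor of [A], by
    restarting there, or of [C], by a detour; an ancestor of [B] alone would connect [A] with
    [B]. *)
Lemma moral_separated a b :
  a \in A -> b \in B -> ~~ connect (moral_edge H S C) a b.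
Proof.
move=> aA bB; apply/negP => /connectP[p ap bE].
have [dAB dAC dBC] := and3P dABC.
have nreach := iffLR (msepPn H dABC) sep.
pose J w := w \in A \/ exists2 a', a' \in A & wreach H C a' w false.
have down a' w h : a' \in A -> wreach H C a' w h -> w \in S -> w \notin C -> J w.
  move=> a'A a'w; rewrite inE => /exists_inP[c cABC wc] wC.
  have [/exists_inP[c' c'C wc']|nC] := boolP [exists c' in C, connect (edge H) w c'].
    by right; exists a' => //; apply: wreach_detour a'w wC c'C wc'.
  have {}nC c' : c' \in C -> ~~ connect (edge H) w c'.
    by move=> c'C; apply: contra nC => wc'; apply/exists_inP; exists c'.
  move: cABC; rewrite !inE -orbA => /or3P[cA|cB|cC].
  - case: (wreach_up wc nC) => [<-|cw]; first by left.
    by right; exists c.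
  - case: (wreach_down (or_intror a'w) wc nC) => [E|[h' a'c]].
      by have := disjointFr dAB a'A; rewrite E cB.
    by case: (nreach _ _ _ a'A cB a'c).
  - by have := nC c cC; rewrite wc.
have up w u : J w -> w \notin C -> edge H u w -> J u.
  move=> Jw wC uw; right; case: Jw => [wA|[a' a'A a'w]].
    by exists w => //; apply: (@wreach1 _ H C w u Bwd).
  by exists a' => //; apply: (wreachS (k := Bwd) a'w) => //; rewrite (negPf wC).
have fwd w u : J w -> w \notin C -> edge H w u -> exists2 a', a' \in A & wreach H C a' u true.
  move=> Jw wC wu; case: Jw => [wA|[a' a'A a'w]].
    by exists w => //; apply: (@wreach1 _ H C w u Fwd).
  by exists a' => //; apply: (wreachS (k := Fwd) a'w) => //; rewrite (negPf wC).
have Jb : J b.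
  have : J a by left.
  elim: p a {aA} ap bE => [|z p IHp] w /=; first by move=> _ ->.
  move=> /andP[+ zp] bE Jw; move=> /and3P[/setDP[wS wC] /setDP[zS zC] wz].
  apply: (IHp z zp bE); case/or3P: wz => [wz|zw|/exists_inP[c cS /andP[wc zc]]].
  - by have [a' a'A a'z] := fwd _ _ Jw wC wz; apply: down a'z zS zC.
  - exact: up Jw wC zw.
  - have [a' a'A a'c] := fwd _ _ Jw wC wc.
    have [cC|cC] := boolP (c \in C).
      by right; exists a' => //; apply: (wreachS (k := Bwd) a'c) => //; rewrite cC.
    exact: up (down _ _ _ a'A a'c cS cC) cC zc.
case: Jb => [bA|[a' a'A a'b]]; first by have := disjointFr dAB bA; rewrite bB.
exact: nreach a'A bB a'b.
Qed.

End Moralization.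

(** * Marginals and conditional independence *)

Local Open Scope ring_scope.

Section Marginals.
Variables (R : realType) (V : finType) (X : V -> finType).
Implicit Types (f g h p : state X -> R) (A B C D P S T W : {set V}) (x y z : state X).

Definition depends_on S f := forall x y, {in S, forall u, x u = y u} -> f x = f y.

Lemma dep_sub S T f : S \subset T -> depends_on S f -> depends_on T f.
Proof. by move=> ST df x y xy; apply: df => u /(subsetP ST); apply: xy. Qed.

Lemma depM S f g : depends_on S f -> depends_on S g -> depends_on S (fun x => f x * g x).
Proof. by move=> df dg x y xy; rewrite (df x y xy) (dg x y xy). Qed.

Lemma depV S f : depends_on S f -> depends_on S (fun x => (f x)^-1).
Proof. by move=> df x y xy; rewrite (df x y xy). Qed.

Lemma dep_prod (I : finType) (Q : pred I) S (k : I -> state X -> R) :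
  (forall i, Q i -> depends_on S (k i)) -> depends_on S (fun x => \prod_(i | Q i) k i x).
Proof. by move=> dk x y xy; apply: eq_bigr => i /dk; apply. Qed.

Definition mix P x y : state X := [ffun u => if u \in P then y u else x u].

Lemma mixE P x y u : mix P x y u = if u \in P then y u else x u.
Proof. by rewrite ffunE. Qed.

(** The coordinates in [P] are changed one at a time. *)
Lemma dep_all P f : {in P, forall u, depends_on (~: [set u]) f} -> depends_on (~: P) f.
Proof.
move=> dP x y xy.
suff key (s : seq V) z : {subset s <= P} -> (forall u, u \notin s -> z u = y u) -> f z = f y.
  apply: (key (enum P)) => [u|u]; rewrite mem_enum // => uP.
  by apply: xy; rewrite inE.
elim: s z => [|u s IHs] z sP zy.
  by congr f; apply/ffunP => u; apply: zy.
have {}sP : u \in P /\ {subset s <= P}.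
  by split=> [|w ws]; apply: sP; rewrite inE ?eqxx // ws orbT.
rewrite (dP u sP.1 z (mix [set u] z y)) => [|w]; last by rewrite mixE !inE => /negPf->.
apply: IHs sP.2 _ => w ws; rewrite mixE inE; case: eqVneq => // wu.
by apply: zy; rewrite inE negb_or wu.
Qed.

Lemma marg_dep_self f S : depends_on S (marg f S).
Proof.
move=> x y xy; apply: eq_bigl => z; apply: eq_forallb => u.
by case: (boolP (u \in S)) => //= uS; rewrite xy.
Qed.

Lemma marg_set0 f x : marg f set0 x = \sum_y f y.
Proof. by apply: eq_bigl => y; apply/forall_inP => u; rewrite inE. Qed.

Lemma eq_marg f g S x : f =1 g -> marg f S x = marg g S x.
Proof. by move=> fg; apply: eq_bigr. Qed.

Lemma marg_mull g f S x : depends_on S g -> marg (fun y => g y * f y) S x = g x * marg f S x.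
Proof.
move=> dg; rewrite /marg big_distrr; apply: eq_bigr => y /forall_inP yx /=.
by congr (_ * _); apply: dg => u uS; apply/eqP/yx.
Qed.

Lemma marg_gt0 f S x : (forall y, 0 < f y) -> 0 < marg f S x.
Proof.
move=> f0; rewrite /marg (bigD1 x) /=; last by apply/forall_inP.
by rewrite ltr_pwDl // sumr_ge0 // => y _; exact: ltW.
Qed.

(** [marg f S] is a function of full states, constant in the coordinates outside [S]. The outer sum
    keeps these fixed, as they lie in [W], so nothing is counted twice. *)
Lemma marg_marg f S W x : S :|: W = setT -> marg (marg f S) W x = marg f (S :&: W) x.
Proof.
move=> SW; rewrite /marg [RHS](partition_big (mix S x)
  (fun y : state X => [forall u in W, y u == x u])) /=.
  apply: eq_bigr => y /forall_inP yx; apply: eq_bigl => z.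
  apply/forall_inP/andP => [zy|[/forall_inP zx /eqP<-] u uS].
    split; first by apply/forall_inP => u /setIP[uS /yx/eqP<-]; apply: zy.
    apply/eqP/ffunP => u; rewrite mixE; case: ifPn => uS; first exact/eqP/zy.
    by rewrite (eqP (yx u _)) //; have := in_setT u; rewrite -SW inE (negPf uS).
  by rewrite mixE uS.
move=> z /forall_inP zx; apply/forall_inP => u uW; rewrite mixE.
by case: ifP => // uS; apply: zx; rewrite inE uS.
Qed.

Lemma marg_sub f S T x : T \subset S -> marg f T x = marg (marg f S) (T :|: ~: S) x.
Proof.
move=> TS; rewrite marg_marg; last by rewrite setUCA setUCr setUT.
by rewrite setIUr setICr setU0 (setIidPr TS).
Qed.

(** The marginal at [x] becomes a sum over the states compatible with [y], so that marginals at [x]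
    and [y] can be compared term by term. *)
Lemma marg_reindex f W P x y : P \subset W -> {in W :\: P, forall u, x u = y u} ->
  marg f W x = \sum_(z : state X | [forall u in W, z u == y u]) f (mix P z x).
Proof.
move=> PW xy; rewrite /marg (reindex_onto (fun z => mix P z x) (fun z => mix P z y)).
  apply: eq_bigl => z; apply/andP/forall_inP => [[/forall_inP zx /eqP E] u uW|zy].
    rewrite -E mixE; case: ifPn => // uP; have := zx u uW.
    by rewrite -xy // inE uP.
  split.
    apply/forall_inP => u uW; rewrite mixE; case: ifPn => // uP.
    by rewrite (eqP (zy u uW)) xy // inE uP.
  apply/eqP/ffunP => u; rewrite !mixE; case: (boolP (u \in P)) => // uP.
  by rewrite (eqP (zy u _)) // (subsetP PW).
move=> z /forall_inP zx; apply/ffunP => u; rewrite !mixE; case: (boolP (u \in P)) => // uP.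
by rewrite (eqP (zx u _)) // (subsetP PW).
Qed.

Lemma marg_dep f W D : depends_on D f -> ~: D \subset W -> depends_on (W :&: D) (marg f W).
Proof.
move=> df DW x y xy; rewrite (marg_reindex f (y := y) DW) => [|u]; last first.
  by rewrite in_setD in_setC negbK => /andP[uD uW]; apply: xy; rewrite inE uW.
apply: eq_bigr => z _; apply: df => u uD.
by rewrite mixE in_setC uD.
Qed.

(** The sum is done in two stages: over the coordinates of [B] outside [T], with [g] as a constant,
    then over those of [A]. *)
Lemma marg_mul_disjoint g h A B C S T x :
  [disjoint A & B] -> [disjoint A & C] -> [disjoint B & C] ->
  A :|: B :|: C = S -> C \subset T -> T \subset S ->
  depends_on (A :|: C) g -> depends_on (B :|: C) h ->
  marg (fun y => g y * h y) (T :|: ~: S) x = marg g (T :|: ~: A) x * marg h (T :|: ~: B) x.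
Proof.
move=> AB AC BC SE CT TS dg dh.
have sub (Q Q' : {set V}) : [disjoint Q & Q'] -> Q \subset ~: Q' by rewrite disjoints_subset.
have -> : T :|: ~: S = (T :|: ~: B) :&: (T :|: ~: A).
  rewrite -setUIr -SE !setCU; apply/setP => u; rewrite !inE.
  by case: (boolP (u \in C)) => [/(subsetP CT)->|_] //; rewrite andbT andbC.
rewrite -marg_marg; last first.
  apply/setP => u; rewrite !inE; case: (boolP (u \in A)) => uA; rewrite ?orbT //.
  by rewrite (disjointFr AB uA) orbT.
rewrite (eq_marg (g := fun y => marg h (T :|: ~: B) y * g y)) => [|y]; last first.
  rewrite marg_mull 1?mulrC //; apply: dep_sub dg.
  rewrite subUset (subset_trans CT (subsetUl _ _)) andbT.
  exact: subset_trans (sub _ _ AB) (subsetUr _ _).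
rewrite marg_mull 1?mulrC //.
apply: dep_sub (marg_dep dh _); last first.
  by rewrite setCU; apply: subset_trans (subsetIl _ _) (subsetUr _ _).
apply/subsetP => u; rewrite !inE => /andP[_ /orP[uB|/(subsetP CT)->//]].
by rewrite (disjointFl AB uB) orbT.
Qed.

(** Each marginal in the two ratios splits into a part from [g], insensitive to [B], and a part from
    [h], insensitive to [A]; then everything cancels. *)
Lemma cond_indep_factor p g h A B C A' B' S : (forall x, 0 < p x) ->
  [disjoint A' & B'] -> [disjoint A' & C] -> [disjoint B' & C] ->
  A' :|: B' :|: C = S -> A \subset A' -> B \subset B' ->
  depends_on (A' :|: C) g -> depends_on (B' :|: C) h ->
  (forall x, marg p S x = g x * h x) -> cond_indep p A B C.
Proof.
move=> p0 AB AC BC SE AA BB dg dh pE x C0.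
have split T : C \subset T -> T \subset S ->
    marg p T x = marg g (T :|: ~: A') x * marg h (T :|: ~: B') x.
  by move=> CT TS; rewrite (marg_sub _ _ TS) (eq_marg _ _ pE) (marg_mul_disjoint _ AB AC BC).
have AS : A \subset S by rewrite -SE -setUA; apply: subset_trans AA (subsetUl _ _).
have BS : B \subset S by rewrite -SE setUAC; apply: subset_trans BB (subsetUr _ _).
have CS : C \subset S by rewrite -SE subsetUr.
have AB' : A \subset ~: B' by apply: subset_trans AA _; rewrite -disjoints_subset.
have BA' : B \subset ~: A'.
  by apply: subset_trans BB _; rewrite -disjoints_subset disjoint_sym.
have drop (Q Q' D E : {set V}) : Q \subset E -> (forall u, (u \in Q') = (u \in D) || (u \in Q)) ->
    Q' :|: E = D :|: E.
  move=> QE Q'E; apply/setP => u; rewrite !in_setU Q'E.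
  by case: (boolP (u \in Q)) => [/(subsetP QE)->|_]; rewrite ?orbF ?orbT.
rewrite /condp !split ?subUset ?AS ?BS ?CS ?subxx ?subsetUr //.
rewrite (drop B (A :|: B :|: C) (A :|: C) (~: A')) //; last by move=> u; rewrite !inE orbAC.
rewrite (drop A (A :|: B :|: C) (B :|: C) (~: B')) //; last first.
  by move=> u; rewrite !inE -orbA orbC.
rewrite (drop A (A :|: C) C (~: B')) //; last by move=> u; rewrite !inE orbC.
rewrite (drop B (B :|: C) C (~: A')) //; last by move=> u; rewrite !inE orbC.
move: C0; rewrite split //; set a := marg g (C :|: _) x; set b := marg h (C :|: _) x.
move=> ab; have := lt0r_neq0 ab; rewrite mulf_eq0 negb_or => /andP[a0 b0].
by field; rewrite a0 b0.
Qed.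

(* For positive [f] proportional to a law: [u] and [w] are conditionally
   independent given all other coordinates. *)
Definition exchangeable f u w := forall x y,
  f x * f (mix [set u; w] x y) = f (mix [set u] x y) * f (mix [set w] x y).

Lemma exchangeableC f u w : exchangeable f u w -> exchangeable f w u.
Proof. by move=> fuw x y; rewrite setUC fuw mulrC. Qed.

Lemma dep_mix f u P x y : depends_on (~: [set u]) f -> f (mix (u |: P) x y) = f (mix P x y).
Proof.
by move=> df; apply: df => w; rewrite !inE !mixE !inE => /negPf->.
Qed.

Lemma dep_mix1 f u x y : depends_on (~: [set u]) f -> f (mix [set u] x y) = f x.
Proof. by move=> df; apply: df => w; rewrite !mixE !inE => /negPf->. Qed.

Lemma exchangeable_mull f g u w :
  depends_on (~: [set u]) g -> exchangeable f u w -> exchangeable (fun x => g x * f x) u w.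
Proof.
move=> dg fuw x y; rewrite (dep_mix _ _ _ dg) (dep_mix1 _ _ dg).
by rewrite mulrACA fuw mulrACA.
Qed.

Lemma exchangeable_mul f g u w :
  depends_on (~: [set u]) g -> depends_on (~: [set w]) f -> exchangeable (fun x => g x * f x) u w.
Proof.
move=> dg df x y; rewrite (dep_mix _ _ _ dg) (dep_mix1 _ _ dg) setUC.
rewrite (dep_mix _ _ _ df) (dep_mix1 _ _ df); ring.
Qed.

Lemma eq_exchangeable f g u w : f =1 g -> exchangeable f u w -> exchangeable g u w.
Proof. by move=> fg fuw x y; rewrite -!fg. Qed.

Lemma cond_indep_exchangeable p u w C : (forall x, 0 < p x) ->
  u != w -> u \notin C -> w \notin C -> cond_indep p [set u] [set w] C ->
  exchangeable (marg p ([set u; w] :|: C)) u w.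
Proof.
move=> p0 uw uC wC ci.
have dC (D : {set V}) b : b \notin D -> depends_on (~: [set b]) (marg p D).
  by move=> bD; apply: dep_sub (@marg_dep_self p D); rewrite subsetC sub1set inE.
pose g x := (marg p C x)^-1 * marg p ([set w] :|: C) x.
apply: (@eq_exchangeable (fun x => g x * marg p ([set u] :|: C) x)) => [x|].
  have C0 := marg_gt0 C x p0; have := ci x C0; rewrite /condp /g.
  move=> /(congr1 ( *%R^~ (marg p C x))); rewrite divfK ?gt_eqF // => ->.
  by field; rewrite gt_eqF.
apply: exchangeable_mul; last by apply: dC; rewrite !inE negb_or eq_sym uw.
by apply: depM; [apply: depV|]; apply: dC; rewrite ?inE ?negb_or ?uw.
Qed.

(** Changing the coordinate [b] multiplies [marg p S] by a factor [r]. By exchangeability [r] does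
    not involve [S :\: T], so it comes out of the sum that yields [marg p T] and cancels in the
    ratio. *)
Lemma marg_ratio_dep p S T b : (forall x, 0 < p x) -> T \subset S -> b \in T ->
  {in S :\: T, forall w, exchangeable (marg p S) w b} ->
  depends_on (~: [set b]) (fun x => marg p S x / marg p T x).
Proof.
move=> p0 TS bT exch x x' xx'; set f := marg p S in exch *.
have f0 z : f z != 0 by apply/lt0r_neq0/marg_gt0.
pose r z := f (mix [set b] z x') / f z.
have dr : depends_on (~: (S :\: T)) r.
  apply: dep_all => w wST z z' zz'.
  have wb : w != b by apply: contraTneq wST => ->; rewrite inE bT.
  have := exch w wST z (mix [set b] z' x').
  rewrite (_ : mix [set w; b] z _ = mix [set b] z' x'); last first.
    apply/ffunP => u; rewrite !mixE !inE; case: (eqVneq u b) => [->|ub]; first by rewrite orbT.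
    by case: (eqVneq u w) => //= uw; apply: zz'; rewrite !inE.
  rewrite (_ : mix [set w] z _ = z'); last first.
    apply/ffunP => u; rewrite !mixE !inE; case: (eqVneq u w) => [->|uw].
      by rewrite (negPf wb).
    by apply: zz'; rewrite !inE.
  rewrite (_ : mix [set b] z _ = mix [set b] z x'); last first.
    by apply/ffunP => u; rewrite !mixE; case: (u \in [set b]).
  by move=> E; rewrite /r; apply/eqP; rewrite eqr_div // mulrC -E mulrC.
have fx' : f x' = r x * f x.
  rewrite /r divfK //; congr f; apply/ffunP => u; rewrite mixE inE.
  by case: eqVneq => // ub; rewrite xx' // !inE.
have mx' : marg p T x' = r x * marg p T x.
  rewrite (marg_sub _ _ TS) (marg_sub _ x TS) (marg_reindex _ (P := [set b]) (y := x)).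
  - rewrite big_distrr; apply: eq_bigr => z /forall_inP zx /=.
    rewrite (dr x z) /r ?divfK // => u; rewrite !inE => uS.
    by apply/esym/eqP/zx; move: uS; rewrite !inE; case: (u \in T); case: (u \in S).
  - by rewrite sub1set inE bT.
  - by move=> u; rewrite !inE => /andP[ub _]; rewrite xx' ?inE.
by rewrite fx' mx' -mulf_div divff ?mul1r // mulf_neq0 // invr_neq0.
Qed.

End Marginals.

(** * Factorization along a DAG *)

Section DagFactorization.
Variables (R : realType) (V : finType) (X : V -> finType) (H : mDAG V).
Variable p : state X -> R.
Hypothesis p_gt0 : forall x, 0 < p x.
Implicit Types (A B C S T : {set V}) (x y z : state X).

Definition dag_family w : {set V} := w |: pa H [set w].

Lemma in_pa1 u w : (u \in pa H [set w]) = edge H u w.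
Proof.
rewrite inE; apply/exists_inP/idP => [[z /set1P->]//|uw].
by exists w; rewrite ?set11.
Qed.

Lemma family_sub S w : ancestral H S -> w \in S -> dag_family w \subset S.
Proof.
move=> Sanc wS; apply/subsetP => u; rewrite in_setU1 in_pa1.
by case/orP => [/eqP->//|uw]; apply: Sanc uw wS.
Qed.

(** [k w] acts as the conditional law of [w] given its parents: [marg (k w) (~: [set w])] sums over
    the coordinate [w] alone. *)
Definition factorizes S := exists k : V -> state X -> R,
  [/\ {in S, forall w, depends_on (dag_family w) (k w)},
      {in S, forall w x, marg (k w) (~: [set w]) x = 1}
    & forall x, marg p S x = \prod_(w in S) k w x].

Lemma factorizes_set0 : (forall x, marg p set0 x = 1) -> factorizes set0.
Proof.
move=> p1; exists (fun _ _ => 1); split=> [w|w|x]; rewrite ?inE //.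
by rewrite p1 big_set0.
Qed.

Lemma dep_setC1 S f (b : V) : b \notin S -> depends_on S f -> depends_on (~: [set b]) (f : state X -> R).
Proof. by move=> bS; apply: dep_sub; rewrite subsetC sub1set inE. Qed.

Lemma ratio_dep_family S w : w \in S ->
  {in S, forall b, b != w -> ~~ edge H b w -> exchangeable (marg p S) w b} ->
  depends_on (dag_family w) (fun x => marg p S x / marg p (S :\ w) x).
Proof.
move=> wS exch; rewrite -[dag_family w]setCK; apply: dep_all => b.
rewrite in_setC in_setU1 in_pa1 negb_or => /andP[bw nbw].
case: (boolP (b \in S)) => bS.
  apply: marg_ratio_dep; rewrite ?subD1set // ?inE ?bw //.
  move=> u; rewrite !inE negb_and negbK => /andP[/orP[/eqP->|/negPf->]//] _.
  exact: exch.
apply: depM; [|apply: depV]; apply: dep_setC1 (@marg_dep_self _ _ _ p _) => //.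
by rewrite inE (negPf bS) andbF.
Qed.

Lemma marg_setD1 S w x : w \in S -> marg p (S :\ w) x = marg (marg p S) (~: [set w]) x.
Proof.
move=> wS; rewrite marg_marg ?setDE //.
by apply/setP => u; rewrite !inE; case: eqVneq => [->|]; rewrite ?wS ?orbT.
Qed.

Lemma factorizes_setD1 S w : w \in S ->
  depends_on (dag_family w) (fun x => marg p S x / marg p (S :\ w) x) ->
  factorizes (S :\ w) -> factorizes S.
Proof.
move=> wS dr [k [kd k1 kE]].
pose r x := marg p S x / marg p (S :\ w) x.
exists (fun u => if u == w then r else k u); split=> [u uS|u uS x|x].
- by case: eqVneq => [->//|uw]; apply: kd; rewrite !inE uw.
- case: eqVneq => [->|uw]; last by apply: k1; rewrite !inE uw.
  rewrite (eq_marg (g := fun y => (marg p (S :\ w) y)^-1 * marg p S y)) => [|y]; last exact: mulrC.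
  rewrite marg_mull; last first.
    by apply: depV; apply: dep_setC1 (@marg_dep_self _ _ _ p _); rewrite !inE eqxx.
  by rewrite -marg_setD1 // mulVf // gt_eqF // marg_gt0.
- rewrite (big_setD1 w) //= eqxx (eq_bigr (fun u => k u x)) => [|u]; last first.
    by rewrite !inE => /andP[/negPf->].
  by rewrite -kE divfK // gt_eqF // marg_gt0.
Qed.

(** A sink [w] of [S] outside [T] is split off: exchangeability with all non-parents makes its law
    given the rest of [S] a function of its family. The bound [T'] limits the sets for which
    exchangeability must be supplied. *)
Lemma factorizes_extend T T' S : ancestral H T -> ancestral H S ->
  T \subset S -> S \subset T' ->
  (forall (S : {set V}) w b, ancestral H S -> T \subset S -> S \subset T' ->
    w \in S :\: T -> {in S, forall u, ~~ edge H w u} -> b \in S -> b != w ->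
    ~~ edge H b w -> exchangeable (marg p S) w b) ->
  factorizes T -> factorizes S.
Proof.
move=> Tanc + + + exch fT; have [n] := ubnP #|S|.
elim: n S => // n IHn S /ltnSE-Sn Sanc TS ST'.
have [/eqP ST|ST] := boolP (S :\: T == set0).
  suff -> : S = T by [].
  by apply/eqP; rewrite eqEsubset TS -setD_eq0 ST eqxx.
have [w wST wsink] := exists_sink H ST; have [wS wT] := setDP wST.
have {}wsink : {in S, forall u, ~~ edge H w u}.
  move=> u uS; case: (boolP (u \in T)) => uT; last by apply: wsink; rewrite inE uT.
  by apply: contra wT => wu; apply: Tanc wu uT.
apply: (factorizes_setD1 wS).
  by apply: (ratio_dep_family wS) => b bS bw nbw; apply: exch.
apply: IHn.
- by move: Sn; rewrite (cardsD1 w) wS.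
- move=> u z uz; rewrite !inE => /andP[zw zS]; rewrite (Sanc _ _ uz zS) andbT.
  by apply: contraTneq uz => ->; apply: wsink.
- by rewrite subsetD1 TS.
- exact: subset_trans (subD1set _ _) ST'.
Qed.

(** A source [w] of the complement keeps [w |: S] ancestral. No family of a vertex of [S] contains
    [w], so summing [w] out removes just the factor [k w]. *)
Lemma factorizes_ancestral S : ancestral H S -> factorizes setT -> factorizes S.
Proof.
move=> + [k [kd k1 kE]].
move=> Sanc; exists k; split=> [w _|w _|]; [by apply: kd|by apply: k1|].
have [n] := ubnP #|~: S|; elim: n S Sanc => // n IHn S Sanc /ltnSE-Sn.
have [/eqP ST|ST] := boolP (~: S == set0).
  by have -> : S = setT; [apply: setC_inj; rewrite ST setCT|].
have [w wS wsrc] := exists_source H ST; rewrite in_setC in wS.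
have SwE : (w |: S) :\ w = S.
  by rewrite setU1K.
have wanc : ancestral H (w |: S).
  move=> u z uz; rewrite !in_setU1 => /orP[/eqP zw|zS]; last by rewrite (Sanc _ _ uz zS) orbT.
  apply/orP; right; apply: contraT => uS; rewrite zw in uz.
  by have := wsrc u; rewrite in_setC uS uz => /(_ isT).
have {}IHn x : marg p (w |: S) x = \prod_(u in w |: S) k u x.
  apply: IHn => //; apply: leq_trans Sn.
  rewrite [X in (_ < X)%N](cardsD1 w) in_setC wS ltnS; apply: subset_leq_card.
  by apply/subsetP => u; rewrite !inE negb_or.
move=> x; rewrite -{1}SwE marg_setD1 ?setU11 // (eq_marg _ _ IHn).
rewrite (eq_marg (g := fun y => (\prod_(u in S) k u y) * k w y)) => [|y]; last first.
  by rewrite big_setU1 // mulrC.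
rewrite marg_mull ?k1 ?inE ?mulr1 //.
apply: dep_prod => u uS; apply: dep_sub (kd u (in_setT u)).
apply: subset_trans (family_sub Sanc uS) _.
by rewrite subsetC sub1set inE.
Qed.

(** Each family is a clique of the moral graph once [C] is removed, so it lies in [A' :|: C] or in
    [B' :|: C], where [A'] is what [A] reaches there. Grouping the factors accordingly gives the
    product [g * h]. *)
Lemma factorizes_global_markov A B C : disjoint3 A B C -> msep H A B C ->
  factorizes setT -> cond_indep p A B C.
Proof.
move=> dABC sep fT.
pose S := [set u | [exists w in A :|: B :|: C, connect (edge H) u w]].
have S_anc : ancestral H S by apply: ancestral_closure.
have SABC u : u \in A :|: B :|: C -> u \in S.
  by move=> uABC; rewrite inE; apply/exists_inP; exists u.
have [k [kd _ kE]] := factorizes_ancestral S_anc fT.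
have [dAB dAC dBC] := and3P dABC.
pose e := moral_edge H S C.
pose A' := [set u in S :\: C | [exists a in A, connect e a u]].
pose B' := S :\: C :\: A'.
pose Q w := dag_family w \subset A' :|: C.
pose g x := \prod_(w in S | Q w) k w x.
pose h x := \prod_(w in S | ~~ Q w) k w x.
have eA' u w : u \in A' -> e u w -> w \in A'.
  rewrite inE => /andP[_ /exists_inP[a aA au]] uw; rewrite inE.
  apply/andP; split; first by case/and3P: uw.
  by apply/exists_inP; exists a => //; apply: connect_trans au (connect1 uw).
have clique w u u' : w \in S -> u \in dag_family w -> u' \in dag_family w ->
    u \notin C -> u' \notin C -> u != u' -> e u u'.
  move=> wS uw zw uC zC uz; have fS := subsetP (family_sub S_anc wS).
  apply/and3P; split; [by rewrite in_setD uC fS|by rewrite in_setD zC fS|].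
  move: uw zw; rewrite !in_setU1 !in_pa1.
  case/orP => [/eqP uw|uw]; case/orP => [/eqP zw|zw].
  - by rewrite uw zw eqxx in uz.
  - by rewrite uw zw orbT.
  - by rewrite zw uw.
  - by apply/or3P; constructor 3; apply/exists_inP; exists w => //; rewrite uw.
have A'S : A' \subset S :\: C by apply/subsetP => u; rewrite inE => /andP[].
apply: (@cond_indep_factor _ _ _ p g h A B C A' B' S) => //.
- by rewrite disjoint_sym disjoints_subset; apply/subsetP => u; rewrite in_setD in_setC => /andP[].
- rewrite disjoints_subset; apply: subset_trans A'S _.
  by apply/subsetP => u; rewrite in_setD in_setC => /andP[].
- rewrite disjoints_subset; apply: subset_trans (subsetDl _ _) _.
  by apply/subsetP => u; rewrite in_setD in_setC => /andP[].
- apply/setP => u; rewrite !in_setU !in_setD.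
  have := subsetP A'S u; have := SABC u; rewrite in_setD !in_setU.
  case: (u \in A'); case: (u \in C); case: (u \in S) => //=; rewrite ?orbT // => SC A'u;
    solve [by have := SC isT | by have := A'u isT].
- apply/subsetP => a aA; rewrite inE in_setD (disjointFr dAC aA) SABC ?in_setU ?aA //=.
  by apply/exists_inP; exists a.
- apply/subsetP => b bB; rewrite !in_setD (disjointFr dBC bB) SABC ?in_setU ?bB ?orbT //= andbT.
  rewrite inE negb_and; apply/orP; right; apply/exists_inP => -[a aA].
  by apply/negP; apply: moral_separated.
- by apply: dep_prod => w /andP[wS Qw]; apply: dep_sub Qw (kd w wS).
- apply: dep_prod => w /andP[wS /subsetPn[u uw]]; rewrite in_setU negb_or => /andP[uA' uC].
  apply: dep_sub (kd w wS); apply/subsetP => u' u'w.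
  rewrite in_setU !in_setD; case: (boolP (u' \in C)) => //= u'C; rewrite ?orbT // orbF.
  rewrite (subsetP (family_sub S_anc wS)) // andbT.
  apply: contra uA' => u'A'; have [<- //|u'u] := eqVneq u' u.
  exact: eA' u'A' (clique w u' u wS u'w uw u'C uC u'u).
- by move=> x; rewrite kE (bigID Q).
Qed.

End DagFactorization.

(** * Marginals and independences of the fixed distribution *)

Section FixedDistribution.
Variables (R : realType) (V : finType) (X : V -> finType) (G : mDAG V) (v : V).
Variables (p : state X -> R) (q : X v -> R).
Hypothesis v_fixable : fixable G v.
Hypothesis p_pos : pos_dist p.
Hypothesis q_pos : pos_dist q.
Hypothesis p_markov : global_markov G p.
Implicit Types (S : {set V}) (x y : state X).
Local Notation pstar := (fix_dist G q p).
Local Notation N := (~: de G v).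

Let p_gt0 x : 0 < p x. Proof. by have [] := p_pos. Qed.
Let phi x : R := q (x v) / condp p [set v] (mb G v) x.

Lemma mb_sub_nd : mb G v \subset N.
Proof. by apply/subsetP => u /(mb_nd v_fixable); rewrite in_setC. Qed.

Lemma phi_dep : depends_on (v |: mb G v) phi.
Proof.
apply: depM; first by move=> x y xy; rewrite xy // setU11.
apply: depV; apply: (depM (f := marg p ([set v] :|: mb G v)));
  first exact: marg_dep_self.
by apply: depV; apply: dep_sub (@marg_dep_self _ _ _ p _); apply: subsetUr.
Qed.

Lemma fix_dist_gt0 x : 0 < pstar x.
Proof.
by rewrite mulr_gt0 // divr_gt0 ?divr_gt0 ?marg_gt0 //; have [] := q_pos.
Qed.

Lemma marg_fix_dist S x : v |: mb G v \subset S -> marg pstar S x = phi x * marg p S x.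
Proof. by move=> vS; apply: marg_mull; apply: dep_sub vS phi_dep. Qed.

Lemma marg_coord x : marg (fun y => q (y v)) (~: [set v]) x = 1.
Proof.
have [_ <-] := q_pos; rewrite /marg.
rewrite (reindex_onto (fun t : X v => [ffun u => dfwith x t u] : state X) (fun y => y v)) /=.
  apply: eq_big => t; last by move=> _; rewrite ffunE dfwith_in.
  rewrite ffunE dfwith_in eqxx andbT; apply/forall_inP => u; rewrite !inE => uv.
  by rewrite ffunE dfwith_out // eq_sym.
move=> y /forall_inP yx; apply/ffunP => u; rewrite ffunE.
case: dfwithP => // w vw; apply/esym/eqP/yx; rewrite !inE eq_sym //.
Qed.

(** By [msep_mb] the denominator of [phi] is also the conditional law of [v] given all of [N], and
    cancels against it. *)
Lemma marg_fix_dist_vN x : marg pstar (v |: N) x = q (x v) * marg p N x.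
Proof.
rewrite marg_fix_dist ?setUS ?mb_sub_nd //.
have vN : v \notin N by rewrite in_setC v_de.
have vmb : v \notin mb G v by apply: contra vN; apply: (subsetP mb_sub_nd).
have ci : cond_indep p [set v] (N :\: mb G v) (mb G v).
  apply: p_markov; last exact: msep_mb.
  rewrite /disjoint3 !disjoints1 vmb in_setD (negPf vN) andbF /=.
  by apply/pred0P => y; rewrite /= in_setD; case: (y \in mb G v); rewrite ?andbF.
have NE : N :\: mb G v :|: mb G v = N.
  by rewrite setDE setUIl (setUC (~: mb _ _)) setUCr setIT; apply/setUidPl/mb_sub_nd.
have mb0 := marg_gt0 (mb G v) x p_gt0; have := ci x mb0.
rewrite {1 3}/condp -setUA NE => /(congr1 ( *%R^~ (marg p (mb G v) x))).
rewrite divfK ?gt_eqF // /phi => ->.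
have c0 : condp p [set v] (mb G v) x != 0.
  by rewrite gt_eqF // divr_gt0 ?marg_gt0.
field; rewrite c0 gt_eqF //.
Qed.

Lemma marg_fix_dist_nd S x : S \subset N -> marg pstar S x = marg p S x.
Proof.
suff NE y : marg pstar N y = marg p N y.
  by move=> SN; rewrite !(marg_sub _ _ SN); apply: eq_marg => y.
have vN : v \notin N by rewrite in_setC v_de.
rewrite -[in LHS](setU1K vN) marg_setD1 ?setU11 // (eq_marg _ _ marg_fix_dist_vN).
rewrite (eq_marg (g := fun y => marg p N y * q (y v))) => [|z]; last exact: mulrC.
rewrite marg_mull ?marg_coord ?mulr1 //.
by apply: dep_setC1 (@marg_dep_self _ _ _ p _).
Qed.

Lemma fix_dist_exchangeable S d u : v |: N \subset S ->
  d \in de G v -> d != v -> d \in S -> u \in S -> d != u ->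
  wsep (fix_vertex G v) (S :\: [set d; u]) d u -> exchangeable (marg pstar S) d u.
Proof.
move=> NS dD dv dS uS du sep; have [vS NS'] : v \in S /\ N \subset S.
  by move: NS; rewrite subUset sub1set => /andP[].
set C := S :\: _ in sep.
have dC : d \notin C by rewrite in_setD set21.
have uC : u \notin C by rewrite in_setD set22.
have SE : [set d; u] :|: C = S.
  by apply/setP => w; rewrite !inE; case: eqVneq => [->|_]; case: eqVneq => [->|_]; rewrite ?dS ?uS.
apply: (@eq_exchangeable _ _ _ (fun x => phi x * marg p S x)).
  by move=> x; rewrite marg_fix_dist // (subset_trans _ NS) // setUS // mb_sub_nd.
apply: exchangeable_mull.
  apply: dep_setC1 phi_dep; rewrite in_setU1 negb_or dv.
  by apply/negP => /(mb_nd v_fixable); rewrite dD.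
rewrite -SE; apply: cond_indep_exchangeable => //; apply: p_markov.
  by rewrite /disjoint3 !disjoints1 inE du dC uC.
by apply/(wsepP G du dC uC); apply: (wsep_fix_transfer v_fixable).
Qed.

Lemma fix_dist_exchangeable_nd S d u : S \subset N -> d \in S -> u \in S -> d != u ->
  wsep (fix_vertex G v) (S :\: [set d; u]) d u -> exchangeable (marg pstar S) d u.
Proof.
move=> SN dS uS du sep; set C := S :\: _ in sep.
have dC : d \notin C by rewrite in_setD set21.
have uC : u \notin C by rewrite in_setD set22.
have SE : [set d; u] :|: C = S.
  by apply/setP => w; rewrite !inE; case: eqVneq => [->|_]; case: eqVneq => [->|_]; rewrite ?dS ?uS.
apply: (@eq_exchangeable _ _ _ (marg p S)) => [x|]; first by rewrite marg_fix_dist_nd.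
have dis3 : disjoint3 [set d] [set u] C by rewrite /disjoint3 !disjoints1 inE du dC uC.
rewrite -SE; apply: cond_indep_exchangeable => //; apply: p_markov => //.
apply: (@msep_fix_nd _ G v) => //; rewrite ?sub1set ?(subsetP SN) //.
  exact: subset_trans (subsetDl _ _) SN.
by apply/wsepP.
Qed.

End FixedDistribution.

(** * Factorization of the fixed distribution along the DAG *)

Section FixedDistributionFactorizes.
Variables (R : realType) (V : finType) (X : V -> finType) (G H : mDAG V) (v : V).
Variables (p : state X -> R) (q : X v -> R).
Hypothesis v_fixable : fixable G v.
Hypothesis p_pos : pos_dist p.
Hypothesis q_pos : pos_dist q.
Hypothesis p_markov : global_markov G p.
Hypothesis H_dag : is_dag H.
Hypothesis H_equiv : forall A B C : {set V}, disjoint3 A B C ->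
  msep H A B C <-> msep (fix_vertex G v) A B C.
Implicit Types (S : {set V}) (x y : state X).
Local Notation pstar := (fix_dist G q p).
Local Notation N := (~: de G v).
(** The smallest ancestral set of [H] that contains [v] and [N]. *)
Local Notation S0 := (N :|: [set u | connect (edge H) u v]).

Lemma fix_wsep_pair S a b : ancestral H S -> a \in S -> b \in S -> a != b ->
  ~~ edge H a b -> ~~ edge H b a -> {in S, forall c, ~~ (edge H a c && edge H b c)} ->
  wsep (fix_vertex G v) (S :\: [set a; b]) a b.
Proof.
move=> Sanc aS bS ab nab nba nch.
apply/(wsep_equiv H_equiv) => //; rewrite ?in_setD ?set21 ?set22 //.
exact: dag_wsep_pair.
Qed.

Let pstar_gt0 := fix_dist_gt0 G p_pos q_pos.

Lemma S0_de u : u \in S0 -> u \in de G v -> connect (edge H) u v.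
Proof. by rewrite in_setU in_setC inE => /orP[/negP//|]. Qed.

Lemma S0_ancestral : ancestral H S0.
Proof.
move=> u w uw; rewrite !in_setU => /orP[wN|].
  by rewrite (nd_ancestral H_equiv uw wN).
by rewrite !inE => wv; rewrite (connect_trans (connect1 uw) wv) orbT.
Qed.

Lemma S0_moral a b c : a \in de G v -> c \in S0 -> a != b ->
  ~~ edge H a b -> ~~ edge H b a -> ~~ (edge H a c && edge H b c).
Proof.
move=> aD cS0 ab nab nba; apply/negP => /andP[ac bc].
have [cD|cN] := boolP (c \in de G v).
  have := dag_moral H_dag H_equiv (S0_de cS0 cD) ac bc ab.
  by rewrite (negPf nab) (negPf nba).
by have := dag_no_edge_nd H_equiv aD cN; rewrite ac.
Qed.

Lemma S0_exchangeable_de a b : a \in S0 -> a \in de G v -> a != v -> b \in S0 -> a != b ->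
  ~~ edge H a b -> ~~ edge H b a -> exchangeable (marg pstar S0) a b.
Proof.
move=> aS aD av bS ab nab nba.
have vS0 : v |: N \subset S0 by rewrite subUset sub1set subsetUl in_setU inE connect0 orbT.
apply: fix_dist_exchangeable => //; apply: fix_wsep_pair => //; first exact: S0_ancestral.
by move=> c cS; apply: S0_moral.
Qed.

(** The remaining case is [a = v] with [b] in [N]. There the marginal on [S0] is [marg p N], free of
    [v], times [q] and the ratio [r], both free of [b]. *)
Lemma S0_exchangeable a b : a \in S0 -> a \in de G v -> b \in S0 -> a != b ->
  ~~ edge H a b -> ~~ edge H b a -> exchangeable (marg pstar S0) a b.
Proof.
move=> aS aD bS ab nab nba.
have [av|av] := eqVneq a v; last exact: S0_exchangeable_de.
rewrite {a}av in aS aD ab nab nba *.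
have [bD|bN] := boolP (b \in de G v).
  by apply: exchangeableC; apply: S0_exchangeable_de => //; rewrite eq_sym.
have vN : v \notin N by rewrite in_setC aD.
have bNN : b \in N by rewrite in_setC.
pose r x := marg pstar S0 x / marg pstar (v |: N) x.
have dr : depends_on (~: [set b]) r.
  apply: marg_ratio_dep => //; first by rewrite subUset sub1set aS subsetUl.
    by rewrite in_setU1 bNN orbT.
  move=> w /setDP[wS]; rewrite in_setU1 in_setC negb_or negbK => /andP[wv wD].
  apply: S0_exchangeable_de => //.
  - by apply: contraNneq bN => <-.
  - exact: (dag_no_edge_nd H_equiv wD bN).
  (* An edge from [b] to [w] would make [b] an ancestor of [v] in [H], hence a descendant of [v] in
     [G]. *)
  - apply: contra bN => bw; apply: (dag_anc_de H_equiv).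
    exact: connect_trans (connect1 bw) (S0_de wS wD).
apply: (@eq_exchangeable _ _ _ (fun x => marg p N x * (q (x v) * r x))).
  move=> x; rewrite mulrA [_ * q _]mulrC -marg_fix_dist_vN //.
  by rewrite /r mulrC divfK // gt_eqF // marg_gt0.
apply: exchangeable_mul; first exact: dep_setC1 vN (@marg_dep_self _ _ _ p N).
apply: depM dr => x y xy; rewrite xy // !inE.
by apply: contraNneq bN => <-.
Qed.

(* Summing out the last vertex [w] divides by its conditional law given its
   parents, which by [S0_moral] involves at most one of [a] and [b]. *)
Lemma S0_sub_exchangeable S a b : ancestral H S -> N \subset S -> S \subset S0 ->
  a \in S -> a \in de G v -> b \in S -> a != b ->
  ~~ edge H a b -> ~~ edge H b a -> exchangeable (marg pstar S) a b.
Proof.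
move=> + + SS0; have [n] := ubnP #|S0 :\: S|.
elim: n S a b SS0 => // n IHn S a b SS0 /ltnSE-Sn Sanc NS aS aD bS ab nab nba.
have [/eqP SE|SE] := boolP (S0 :\: S == set0).
  have <- : S0 = S by apply/eqP; rewrite eqEsubset SS0 -setD_eq0 SE eqxx.
  by apply: S0_exchangeable => //; apply: (subsetP SS0).
have [w wSS wsrc] := exists_source H SE; have [wS0 wS] := setDP wSS.
have wD : w \in de G v by apply: contraNT wS => wN; rewrite (subsetP NS) // in_setC.
have wanc : ancestral H (w |: S).
  move=> u z uz; rewrite !in_setU1 => /orP[/eqP zw|zS]; last by rewrite (Sanc _ _ uz zS) orbT.
  rewrite zw in uz; apply/orP; right; apply: contraT => uS.
  by have := wsrc u; rewrite in_setD uS (S0_ancestral uz wS0) uz => /(_ isT).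
have wSS0 : w |: S \subset S0 by rewrite subUset sub1set wS0.
have {}IHn c d : c \in w |: S -> c \in de G v -> d \in w |: S -> c != d ->
    ~~ edge H c d -> ~~ edge H d c -> exchangeable (marg pstar (w |: S)) c d.
  apply: IHn => //; last by apply: subset_trans NS (subsetUr _ _).
  apply: leq_trans Sn; rewrite [X in (_ < X)%N](cardsD1 w) wSS ltnS; apply: subset_leq_card.
  by apply/subsetP => u; rewrite !in_setD in_setU1 negb_or in_set1 => /andP[/andP[-> ->]].
have wsink u : u \in S -> ~~ edge H w u.
  by move=> uS; apply: contra wS => wu; apply: Sanc wu uS.
pose r x := marg pstar (w |: S) x / marg pstar S x.
have dr : depends_on (dag_family H w) r.
  have := @ratio_dep_family _ _ _ H _ pstar_gt0 (w |: S) w (setU11 _ _).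
  rewrite setU1K //; apply => b' b'S b'w nb'.
  apply: IHn => //; rewrite ?setU11 1?eq_sym //; apply: wsink.
  by move: b'S; rewrite in_setU1 (negPf b'w).
have dr' c : c \in S -> ~~ edge H c w -> depends_on (~: [set c]) (fun x => (r x)^-1).
  move=> cS ncw; apply: depV; apply: dep_setC1 dr.
  rewrite in_setU1 in_pa1 negb_or ncw andbT.
  by apply: contraNneq wS => <-.
have rE x : (r x)^-1 * marg pstar (w |: S) x = marg pstar S x.
  by rewrite /r invf_div divfK // gt_eqF // marg_gt0.
have {}IHn : exchangeable (marg pstar (w |: S)) a b.
  by apply: IHn; rewrite ?in_setU1 ?aS ?bS ?orbT.
apply: eq_exchangeable rE _.
have := S0_moral aD wS0 ab nab nba; rewrite negb_and => /orP[naw|nbw].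
  by apply: exchangeable_mull IHn; apply: dr'.
by apply: exchangeableC; apply: exchangeable_mull (exchangeableC IHn); apply: dr'.
Qed.

(** Three stages lead from the empty set to [N], to [S0] and to [setT]. Exchangeability comes from
    the marginals of [p], from [S0_sub_exchangeable], and, once [v] is in [S], from
    [fix_dist_exchangeable]. *)
Lemma fix_dist_factorizes : factorizes H pstar setT.
Proof.
have N_anc := nd_ancestral H_equiv.
have nch S w b : {in S, forall u, ~~ edge H w u} ->
    {in S, forall c, ~~ (edge H w c && edge H b c)}.
  by move=> wsink c /wsink/negPf->.
have f0 : factorizes H pstar set0.
  apply: factorizes_set0 => x; rewrite (marg_fix_dist_nd v_fixable) ?sub0set //.
  by rewrite marg_set0; have [] := p_pos.
have fN : factorizes H pstar N.
  apply: (factorizes_extend pstar_gt0 (T := set0) (T' := N)) f0 => //.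
  - by move=> u w _; rewrite inE.
  - exact: sub0set.
  - move=> S w b Sanc _ SN /setDP[wS _] wsink bS bw nbw.
    apply: fix_dist_exchangeable_nd => //; first by rewrite eq_sym.
    apply: fix_wsep_pair => //; [by rewrite eq_sym|exact: wsink|exact: nch].
have fS0 : factorizes H pstar S0.
  apply: (factorizes_extend pstar_gt0 (T := N) (T' := S0)) fN => //.
  - exact: S0_ancestral.
  - exact: subsetUl.
  - move=> S w b Sanc NS SS0 /setDP[wS wN] wsink bS bw nbw.
    rewrite in_setC negbK in wN.
    by apply: S0_sub_exchangeable => //; [rewrite eq_sym|exact: wsink].
apply: (factorizes_extend pstar_gt0 (T := S0) (T' := setT)) fS0 => //.
- exact: S0_ancestral.
- move=> S w b Sanc SS0 _ /setDP[wS]; rewrite in_setU in_setC inE negb_or negbK.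
  move=> /andP[wD wv] wsink bS bw nbw.
  apply: fix_dist_exchangeable => //.
  + by apply: subset_trans SS0; rewrite subUset sub1set subsetUl in_setU inE connect0 orbT.
  + by apply: contraNneq wv => ->.
  + by rewrite eq_sym.
  apply: fix_wsep_pair => //; [by rewrite eq_sym|exact: wsink|exact: nch].
Qed.

End FixedDistributionFactorizes.

Theorem proposition3p2 (R : realType) (V : finType) (G : mDAG V) (v : V)
  (v_fixable : fixable G v)
  (v_nontrivial : nontrivial_nested_constraint R G v) :
  ~ exists H : mDAG V,
      is_dag H /\
      forall A B C : {set V}, disjoint3 A B C ->
        (msep H A B C <-> msep (fix_vertex G v) A B C).
Proof.
case=> H [H_dag H_equiv].
have [A [B [C [dABC sep [X [p [q [p_pos q_pos p_markov nci]]]]]]]] := v_nontrivial.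
apply: nci; apply: (factorizes_global_markov (H := H)) => //.
- exact: fix_dist_gt0.
- exact/H_equiv.
- exact: fix_dist_factorizes.
Qed.
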